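(* Let $\mathcal{E}$ be the category dual to the category of commutative rings, and let $\mathfrak{P}$ be the class of those morphisms of $\mathcal{E}$ that correspond to pure morphisms of commutative rings. Then $\mathfrak{P}$ does not satisfy the following condition: the coequalizer of every parallel pair of $\mathfrak{P}$-morphisms exists in $\mathcal{E}$, and is stable under pullback along $\mathfrak{P}$-morphisms.
   Context: Rings are commutative with $1$ and ring morphisms preserve $1$. A morphism $p : B\to E$ of commutative rings is pure if it is pure as a morphism of $B$-modules, i.e. if for every $B$-module $N$ the map $N\otimes_B p : N\otimes_B B\to N\otimes_B E$ is a monomorphism. The category $\mathcal{E}$ has pullbacks, given by pushouts $E\otimes_B E'$ of commutative rings. A coequalizer diagram $X \rightrightarrows Y \to Z$ of a parallel pair of $\mathfrak{P}$-morphisms in $\mathcal{E}$ is stable under pullback along $\mathfrak{P}$-morphisms if for every morphism $Z' \to Z$ in $\mathfrak{P}$ the diagram $Z'\times_Z X \rightrightarrows Z'\times_Z Y \to Z'$ obtained by pulling back along $Z'\to Z$ is again a coequalizer diagram in $\mathcal{E}$. *)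

(* Defs.v *)
From HB Require Import structures.
From mathcomp Require Import all_boot all_algebra.
From mathcomp Require Import boolp freeg.

Set Implicit Arguments.
Unset Strict Implicit.
Unset Printing Implicit Defensive.

Import GRing.Theory.

Local Open Scope ring_scope.
Local Open Scope quotient_scope.

Record category := Category {
  obj :> Type;
  hom : obj -> obj -> Type;
  idm : forall X, hom X X;
  comp : forall X Y Z, hom Y Z -> hom X Y -> hom X Z;
  comp1m : forall X Y (f : hom X Y), comp (idm Y) f = f;
  compm1 : forall X Y (f : hom X Y), comp f (idm X) = f;
  compmA : forall X Y Z W (h : hom Z W) (g : hom Y Z) (f : hom X Y),
    comp h (comp g f) = comp (comp h g) f
}.

Arguments idm {c} X.
Arguments comp {c X Y Z} g f.

Definition opposite (C : category) : category :=
  @Category C (fun X Y => hom Y X) (fun X => idm X)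
    (fun X Y Z g f => comp f g)
    (fun X Y f => compm1 f) (fun X Y f => comp1m f)
    (fun X Y Z W h g f => esym (compmA f g h)).

Definition morphism_class (C : category) := forall X Y : C, hom X Y -> Prop.

Section Diagrams.
Variable C : category.

Definition is_coequalizer (X Y Z : C) (f g : hom X Y) (q : hom Y Z) : Prop :=
  comp q f = comp q g /\
  forall (W : C) (t : hom Y W), comp t f = comp t g ->
    exists! u : hom Z W, comp u q = t.

Definition is_pullback (P X Y Z : C) (p1 : hom P X) (p2 : hom P Y)
    (f : hom X Z) (g : hom Y Z) : Prop :=
  comp f p1 = comp g p2 /\
  forall (W : C) (t1 : hom W X) (t2 : hom W Y), comp f t1 = comp g t2 ->
    exists! u : hom W P, comp p1 u = t1 /\ comp p2 u = t2.

(** [PX] and [PY] are Z' x_Z X and Z' x_Z Y, where X lies over Z via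
    q o f = q o g; [f'] and [g'] are the morphisms Z' x_Z f and Z' x_Z g.
    Pullbacks being determined up to isomorphism only, all choices of them are
    considered. *)
Definition stable_coequalizer (P : morphism_class C) (X Y Z : C)
    (f g : hom X Y) (q : hom Y Z) : Prop :=
  forall (Z' : C) (h : hom Z' Z), P Z' Z h ->
  forall (PX PY : C) (a1 : hom PX Z') (a2 : hom PX X)
         (b1 : hom PY Z') (b2 : hom PY Y) (f' g' : hom PX PY),
    is_pullback a1 a2 h (comp q f) ->
    is_pullback b1 b2 h q ->
    comp b1 f' = a1 -> comp b2 f' = comp f a2 ->
    comp b1 g' = a1 -> comp b2 g' = comp g a2 ->
    is_coequalizer f' g' b1.

Definition has_stable_coequalizers (P : morphism_class C) : Prop :=
  forall (X Y : C) (f g : hom X Y), P X Y f -> P X Y g ->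
    exists (Z : C) (q : hom Y Z),
      is_coequalizer f g q /\ stable_coequalizer P f g q.

End Diagrams.

(** N (x)_R M is the free abelian group on N * M modulo the subgroup generated
    by the bilinearity and balancing relations. *)
Section Tensor.
Variables (R : comPzRingType) (N M : lmodType R).

Definition tensor_free : zmodType := {freeg (N * M)%type / int}.

Definition tensor_gen (n : N) (m : M) : tensor_free := << (n, m) >>.

Local Notation F := tensor_free.
Local Notation e := tensor_gen.

Inductive tensor_rel : F -> Prop :=
| TensorRelDl n1 n2 m : tensor_rel (e (n1 + n2) m - e n1 m - e n2 m)
| TensorRelDr n m1 m2 : tensor_rel (e n (m1 + m2) - e n m1 - e n m2)
| TensorRelZ a n m : tensor_rel (e (a *: n) m - e n (a *: m))
| TensorRel0 : tensor_rel 0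
| TensorRelB x y : tensor_rel x -> tensor_rel y -> tensor_rel (x - y).

Definition tensor_ker : {pred F} := [pred x | `[< tensor_rel x >]].

Lemma tensor_ker_zmod_closed : zmod_closed tensor_ker.
Proof.
split=> [|x y]; rewrite !inE; first exact/asboolP/TensorRel0.
by move=> /asboolP x0 /asboolP y0; apply/asboolP/TensorRelB.
Qed.

HB.instance Definition _ :=
  GRing.isZmodClosed.Build F tensor_ker tensor_ker_zmod_closed.

Local Notation T := (Quotient.quot tensor_ker).

Definition tensor : zmodType := T.

Definition tens (n : N) (m : M) : tensor := \pi_T (e n m).

Lemma tens_eq (x y : F) : tensor_rel (x - y) ->
  \pi_T x = \pi_T y.
Proof.
by move=> xy; apply/eqP; rewrite -Quotient.idealrBE inE; apply/asboolP.
Qed.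

Lemma tensDl n1 n2 m : tens (n1 + n2) m = tens n1 m + tens n2 m.
Proof.
rewrite -raddfD; apply: tens_eq; rewrite opprD addrA; exact: TensorRelDl.
Qed.

Lemma tensDr n m1 m2 : tens n (m1 + m2) = tens n m1 + tens n m2.
Proof.
rewrite -raddfD; apply: tens_eq; rewrite opprD addrA; exact: TensorRelDr.
Qed.

Lemma tensZ a n m : tens (a *: n) m = tens n (a *: m).
Proof. exact/tens_eq/TensorRelZ. Qed.

Lemma tensor_ind (P : tensor -> Prop) :
  (forall n m, P (tens n m)) -> (forall x y, P x -> P y -> P (x - y)) ->
  forall x, P x.
Proof.
move=> Pt PB.
have P0 : P 0 by rewrite -(subrr (tens 0 0)); apply: PB.
have PN x : P x -> P (- x) by move=> Px; rewrite -sub0r; apply: PB.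
have PD x y : P x -> P y -> P (x + y).
  by move=> Px /PN Py; rewrite -[y]opprK; apply: PB.
move=> x; rewrite -[x]reprK; set y : {freeg (N * M)%type / int} := repr x.
elim/freeg_ind_dom0: y => [|k [n m] D _ _ PyD]; first by rewrite [X in P X]raddf0.
rewrite [X in P X]raddfD; apply: (PD) PyD.
have -> : << k *g (n, m) >> = e n m *~ k :> F.
  by rewrite -[k in LHS]intz -freegU_mulz.
rewrite raddfMz.
have Pn j : P (tens n m *+ j) by elim: j => // j IH; rewrite mulrS; apply: PD.
by case: k => j; [apply: Pn | apply: PN; apply: Pn].
Qed.

(** The universal property: a biadditive balanced map [b] induces an additive
    map on the tensor product. *)
Section Lift.
Variables (V : zmodType) (b : N -> M -> V).

Definition tensor_lift (x : tensor) : V :=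
  fglift (fun nm : N * M => b nm.1 nm.2 : zmodule V) (repr x).

Hypothesis bDl : forall n1 n2 m, b (n1 + n2) m = b n1 m + b n2 m.
Hypothesis bDr : forall n m1 m2, b n (m1 + m2) = b n m1 + b n m2.
Hypothesis bZ : forall a n m, b (a *: n) m = b n (a *: m).

Let fgl : F -> V := fglift (fun nm : N * M => b nm.1 nm.2 : zmodule V).

Let fglU n m : fgl (e n m) = b n m.
Proof. by rewrite /fgl liftU scale1r. Qed.

Let fglB : {morph fgl : x y / x - y}.
Proof.
exact: (lift_is_additive (fun nm : N * M => b nm.1 nm.2 : zmodule V)).
Qed.

Lemma tensor_lift_pi x : tensor_lift (\pi_T x) = fgl x.
Proof.
apply/eqP; rewrite -subr_eq0 -fglB; apply/eqP.
have : repr (\pi_T x) - x \in tensor_ker.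
  by rewrite Quotient.idealrBE reprK.
rewrite inE => /asboolP; elim=> {x}.
- by move=> n1 n2 m; rewrite !fglB !fglU /= bDl addrAC addrK subrr.
- by move=> n m1 m2; rewrite !fglB !fglU /= bDr addrAC addrK subrr.
- by move=> a n m; rewrite fglB !fglU /= bZ subrr.
- by rewrite -(subrr 0) fglB subrr.
- by move=> x y _ x0 _ y0; rewrite fglB x0 y0 subrr.
Qed.

Lemma tensor_liftE n m : tensor_lift (tens n m) = b n m.
Proof. by rewrite tensor_lift_pi fglU. Qed.

Lemma tensor_lift_zmod_morphism : zmod_morphism tensor_lift.
Proof.
move=> x y; rewrite -[x]reprK -[y]reprK -raddfB !tensor_lift_pi.
exact: fglB.
Qed.

End Lift.
End Tensor.

(** N (x)_R f *)
Definition tensor_map (R : comPzRingType) (N M M' : lmodType R)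
    (f : {linear M -> M'}) : tensor N M -> tensor N M' :=
  tensor_lift (fun n m => tens n (f m)).

Lemma tensor_mapE (R : comPzRingType) (N M M' : lmodType R)
    (f : {linear M -> M'}) (n : N) (m : M) :
  tensor_map f (tens n m) = tens n (f m).
Proof.
apply: tensor_liftE => *; rewrite ?linearD ?linearZ ?tensDl ?tensDr //.
exact: tensZ.
Qed.

Lemma tensor_map_zmod_morphism (R : comPzRingType) (N M M' : lmodType R)
    (f : {linear M -> M'}) : zmod_morphism (@tensor_map R N M M' f).
Proof.
apply: tensor_lift_zmod_morphism => *;
  rewrite ?linearD ?linearZ ?tensDl ?tensDr //; exact: tensZ.
Qed.

(** The codomain E of a ring morphism p : B -> E, as a B-module. *)
Definition restr (B E : comPzRingType) (p : {rmorphism B -> E}) : Type := E.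

Section Restriction.
Variables (B E : comPzRingType) (p : {rmorphism B -> E}).

HB.instance Definition _ := GRing.Zmodule.on (restr p).

Definition restr_scale (b : B) (x : restr p) : restr p := p b * (x : E).

Fact restr_scaleA a b x : restr_scale a (restr_scale b x) = restr_scale (a * b) x.
Proof. by rewrite /restr_scale rmorphM mulrA. Qed.

Fact restr_scale1 : left_id 1 restr_scale.
Proof. by move=> x; rewrite /restr_scale rmorph1 mul1r. Qed.

Fact restr_scaleDr : right_distributive restr_scale +%R.
Proof. by move=> a x y; apply: mulrDr. Qed.

Fact restr_scaleDl x : {morph restr_scale^~ x : a b / a + b}.
Proof. by move=> a b; rewrite /restr_scale rmorphD; apply: mulrDl. Qed.

HB.instance Definition _ := GRing.Zmodule_isLmodule.Build B (restr p)
  restr_scaleA restr_scale1 restr_scaleDr restr_scaleDl.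

Definition to_restr (b : B^o) : restr p := p b.

Fact to_restr_is_linear : linear to_restr.
Proof. by move=> a x y; rewrite /to_restr rmorphD rmorphM. Qed.

HB.instance Definition _ :=
  GRing.isLinear.Build B B^o (restr p) _ to_restr to_restr_is_linear.

(** Monomorphisms of modules are the injective linear maps. *)
Definition pure : Prop :=
  forall N : lmodType B, injective (@tensor_map B N B^o (restr p) to_restr).

End Restriction.

Lemma rmorphism_eq (R S : comPzRingType) (f g : {rmorphism R -> S}) :
  f =1 g -> f = g.
Proof.
move=> fg; case: f g fg => f cf [g cg] /= /funext fg.
rewrite fg in cf *; congr GRing.RMorphism.Pack.
case: cf cg => [[fa] [fm]] [[ga] [gm]].
by rewrite (Prop_irrelevance fa ga) (Prop_irrelevance fm gm).
Qed.

Definition comRing_id (R : comPzRingType) : {rmorphism R -> R} := idfun.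

Definition comRing_comp (R S T : comPzRingType) (g : {rmorphism S -> T})
    (f : {rmorphism R -> S}) : {rmorphism R -> T} := g \o f.

Lemma comRing_comp1m (R S : comPzRingType) (f : {rmorphism R -> S}) :
  comRing_comp (comRing_id S) f = f.
Proof. exact: rmorphism_eq. Qed.

Lemma comRing_compm1 (R S : comPzRingType) (f : {rmorphism R -> S}) :
  comRing_comp f (comRing_id R) = f.
Proof. exact: rmorphism_eq. Qed.

Lemma comRing_compmA (R S T U : comPzRingType) (h : {rmorphism T -> U})
    (g : {rmorphism S -> T})
    (f : {rmorphism R -> S}) :
  comRing_comp h (comRing_comp g f) = comRing_comp (comRing_comp h g) f.
Proof. exact: rmorphism_eq. Qed.

(** [comPzRingType] is the type of all commutative rings with 1, the zero ring
    included. *)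
Definition comRing : category :=
  Category comRing_comp1m comRing_compm1 comRing_compmA.

Definition dualComRing : category := opposite comRing.

(** A morphism X -> Y of the dual category is a ring morphism Y -> X. *)
Definition dual_pure : morphism_class dualComRing :=
  fun (X Y : comPzRingType) (f : {rmorphism Y -> X}) => pure f.

(* Main.v *)
(** Let [Y = Z * Z] and [X = Z * Z * F_3], with the two maps
    [(a, b) |-> (a, b, a)] and [(a, b) |-> (a, b, b)], which are pure because
    the projection [X -> Y] is a retraction of both. Their equalizer in rings is
    [E = {(a, b) | a = b mod 3}], on which [(a, b) |-> 2a - b mod 9] is a ring
    morphism [phi : E -> Z/9], although it is not one on [Y]. The map
    [(id, phi) : E -> E * Z/9] has a retraction, hence is pure. The kernel of
    [phi] contains [(3, -3)], which generates the ideal [3Y] of [Y], so the base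
    change of [E -> Y] along [phi] is the non-injective map
    [Z/9 -> Y/3Y = F_3 * F_3]. Hence the base change of the equalizer along
    [E -> E * Z/9] is not an equalizer. *)
From HB Require Import structures.
From mathcomp Require Import all_boot all_algebra ring.
Require Import Defs.

Set Implicit Arguments.
Unset Strict Implicit.
Unset Printing Implicit Defensive.

Import GRing.Theory.

Local Open Scope ring_scope.

(** * Purity of split monomorphisms *)

Lemma retract_pure (B E : comPzRingType) (p : {rmorphism B -> E})
    (r : {rmorphism E -> B}) : cancel p r -> pure p.
Proof.
move=> pK N.
(* This is [N (x) r], a left inverse of [N (x) p]; it is balanced because
   [r (p a * x) = a * r x]. *)
pose rN : tensor N (restr p) -> tensor N B^o :=
  tensor_lift (fun n (x : restr p) => tens n (r x : B^o)).
have bDl n1 n2 (x : restr p) :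
    tens (n1 + n2) (r x : B^o) = tens n1 (r x : B^o) + tens n2 (r x : B^o).
  exact: tensDl.
have bDr n (x y : restr p) :
    tens n (r (x + y) : B^o) = tens n (r x : B^o) + tens n (r y : B^o).
  by rewrite -tensDr rmorphD.
have bZ a n (x : restr p) :
    tens (a *: n) (r x : B^o) = tens n (r (a *: x) : B^o).
  by rewrite tensZ [a *: x]/(p a * (x : E)) rmorphM pK.
have rNE n x : rN (tens n x) = tens n (r x : B^o) by apply: tensor_liftE.
have rNB : zmod_morphism rN by apply: tensor_lift_zmod_morphism.
apply: (can_inj (g := rN)) => x; elim/tensor_ind: x => [n m|x y IHx IHy].
  by rewrite tensor_mapE rNE /to_restr pK.
by rewrite tensor_map_zmod_morphism rNB IHx IHy.
Qed.

Lemma rmorphism_of (R S : comPzRingType) (u : R -> S) :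
  zmod_morphism u -> monoid_morphism u ->
  exists v : {rmorphism R -> S}, v =1 u.
Proof.
move=> uB uM.
pose u_add := GRing.isZmodMorphism.Build R S u uB.
pose u_mul := GRing.isMonoidMorphism.Build R S u uM.
pose v : {rmorphism R -> S} := HB.pack u u_add u_mul.
by exists v.
Qed.

(** * Morphisms into products, and a pushout of products *)

Section PairMorphism.
Variables (R S T : comPzRingType) (f : {rmorphism R -> S}).
Variable (g : {rmorphism R -> T}).

Definition pair_rmorph (x : R) : S * T := (f x, g x).

Fact pair_rmorph_is_zmod_morphism : zmod_morphism pair_rmorph.
Proof. by move=> x y; rewrite /pair_rmorph !rmorphB. Qed.

Fact pair_rmorph_is_monoid_morphism : monoid_morphism pair_rmorph.
Proof.
by split=> [|x y]; rewrite /pair_rmorph ?rmorph1 // !rmorphM.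
Qed.

HB.instance Definition _ := GRing.isZmodMorphism.Build R (S * T)%type
  pair_rmorph pair_rmorph_is_zmod_morphism.
HB.instance Definition _ := GRing.isMonoidMorphism.Build R (S * T)%type
  pair_rmorph pair_rmorph_is_monoid_morphism.

End PairMorphism.

Definition prod_rmorph (R R' S S' : comPzRingType) (f : {rmorphism R -> R'})
    (g : {rmorphism S -> S'}) : {rmorphism (R * S)%type -> (R' * S')%type} :=
  pair_rmorph (f \o fst) (g \o snd).

(** The hypotheses make [T] the quotient of [A] by the ideal that the kernel of
    [phi] generates, that is [T = S (x)_E A], so that
    [(E * S) (x)_E A = A * T]. *)
Lemma prod_pushout (E S A T : comPzRingType) (phi : {rmorphism E -> S})
    (q : {rmorphism E -> A}) (pi : {rmorphism A -> T})
    (psi : {rmorphism S -> T}) (sec : T -> A) (g : E) :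
    (forall s, exists z, phi z = s) -> (forall z, psi (phi z) = pi (q z)) ->
    cancel sec pi -> phi g = 0 ->
    (forall x, pi x = 0 -> exists y, x = q g * y) ->
  @is_pullback dualComRing (A * T)%type (E * S)%type A E
    (prod_rmorph q psi) (pair_rmorph idfun pi) (pair_rmorph idfun phi) q.
Proof.
move=> phi_surj psiE secK phig ker_pi; split.
  apply: rmorphism_eq => z.
  by rewrite /= /pair_rmorph /= psiE.
move=> W t1 t2 t12.
have {}t12 z : t1 (z, phi z) = t2 (q z).
  exact: (congr1 (fun h : {rmorphism E -> W} => h z) t12).
(* The idempotent [e] splits [W]; on the summand [W * e] the element [t2 (q g)] vanishes, so [t2]
   factors through [pi] there. *)
pose e : W := t1 (0, 1).
have ee : e * e = e.
  by rewrite -rmorphM; congr (t1 _); congr pair; rewrite /= ?mulr1 ?mulr0.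
have ge : t2 (q g) * e = 0.
  rewrite -t12 -rmorphM phig.
  have -> : (g, 0) * (0, 1) = 0 :> E * S by congr pair; rewrite /= ?mulr0 ?mul0r.
  exact: rmorph0.
have pi_e x y : pi x = pi y -> t2 x * e = t2 y * e.
  move=> /eqP; rewrite -subr_eq0 -rmorphB => /eqP/ker_pi[v xyv].
  by apply/eqP; rewrite -subr_eq0 -mulrBl -rmorphB xyv rmorphM mulrAC ge mul0r.
pose u (p : A * T) := t2 p.1 * (1 - e) + t2 (sec p.2) * e.
have uB : zmod_morphism u.
  move=> [x1 x2] [y1 y2]; rewrite /u /=.
  rewrite (@pi_e _ (sec x2 - sec y2)); last by rewrite rmorphB !secK.
  by rewrite !rmorphB; ring.
have uM : monoid_morphism u.
  split=> [|[x1 x2] [y1 y2]]; rewrite /u /=.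
    by rewrite (@pi_e _ 1) ?secK ?rmorph1 // !mul1r subrK.
  rewrite (@pi_e _ (sec x2 * sec y2)); last by rewrite rmorphM !secK.
  rewrite !rmorphM.
  (* Idempotence is not a ring identity, so the middle term isolates each [e * e]. *)
  transitivity (t2 x1 * t2 y1 * (1 - e - e + e * e) +
    t2 (sec x2) * t2 (sec y2) * (e * e) +
    (t2 x1 * t2 (sec y2) + t2 y1 * t2 (sec x2)) * (e - e * e)).
    by rewrite ee; ring.
  by ring.
have [v vE] := rmorphism_of uB uM.
exists v; split; first split.
- apply: rmorphism_eq => -[z s] /=; rewrite /pair_rmorph vE /u /=.
  (* With [w] over [s], [q w] may replace [sec (psi s)], and [t2 (q w)] is [t1 (w, s)]. *)
  have [w ws] := phi_surj s.
  rewrite (@pi_e _ (q w)); last by rewrite secK -ws psiE.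
  rewrite -!t12 ws -(rmorph1 t1) -rmorphB -!rmorphM -rmorphD; congr (t1 _).
  congr pair; rewrite /=; ring.
- apply: rmorphism_eq => x /=; rewrite /pair_rmorph vE /u /=.
  by rewrite (@pi_e _ x) ?secK // -mulrDr subrK mulr1.
move=> v' [v'1 v'2]; apply: rmorphism_eq => -[x t]; rewrite vE /u /=.
(* Once [(0, 1)] goes to [e], the rest is forced by [(x, t) = (x, pi x) * (1 - (0, 1)) + (sec t, t)
   * (0, 1)]. *)
have v'e : v' (0, 1) = e.
  rewrite /e -v'1 /= /pair_rmorph /=.
  by rewrite rmorph0 rmorph1.
rewrite -v'2 /= /pair_rmorph -v'e -(rmorph1 v') -rmorphB -!rmorphM -rmorphD /=.
congr (v' _); congr pair; rewrite /= ?secK; ring.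
Qed.

(** * Reduction modulo 3 on the integers and on Z/9 *)

Lemma intr_F3_eq0 (n : int) : (n%:~R == 0 :> 'F_3) = (3 %| n)%Z.
Proof. by rewrite -(dvdz_pcharf (@pchar_Fp 3 isT)). Qed.

Definition Zp9_to_F3 (x : 'Z_9) : 'F_3 := (x : nat)%:R.

Lemma natr_mod9 n : (n %% 9)%:R = n%:R :> 'F_3.
Proof.
rewrite [in RHS](divn_eq n 9) natrD natrM.
by rewrite (_ : 9%:R = 0) ?mulr0 ?add0r //; apply: val_inj.
Qed.

Fact Zp9_to_F3_is_zmod_morphism : zmod_morphism Zp9_to_F3.
Proof.
suff fD x y : Zp9_to_F3 (x + y) = Zp9_to_F3 x + Zp9_to_F3 y.
  by move=> x y; apply/eqP; rewrite eq_sym subr_eq -fD subrK.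
by rewrite /Zp9_to_F3 [nat_of_ord _]/= natr_mod9 natrD.
Qed.

Fact Zp9_to_F3_is_monoid_morphism : monoid_morphism Zp9_to_F3.
Proof.
by split=> // x y; rewrite /Zp9_to_F3 [nat_of_ord _]/= natr_mod9 natrM.
Qed.

HB.instance Definition _ := GRing.isZmodMorphism.Build 'Z_9 'F_3
  Zp9_to_F3 Zp9_to_F3_is_zmod_morphism.
HB.instance Definition _ := GRing.isMonoidMorphism.Build 'Z_9 'F_3
  Zp9_to_F3 Zp9_to_F3_is_monoid_morphism.

(** * The parallel pair *)

Definition Y := (int * int)%type.
Definition X := (Y * 'F_3)%type.

Definition Y_X1 : {rmorphism Y -> X} := pair_rmorph idfun (intr \o fst).
Definition Y_X2 : {rmorphism Y -> X} := pair_rmorph idfun (intr \o snd).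

Lemma Y_X1_pure : pure Y_X1.
Proof. exact: (@retract_pure _ _ _ (fst : {rmorphism X -> Y})). Qed.

Lemma Y_X2_pure : pure Y_X2.
Proof. exact: (@retract_pure _ _ _ (fst : {rmorphism X -> Y})). Qed.

(** A morphism out of [{poly int}] amounts to an element, the image of ['X], so these morphisms turn
    universal properties into statements about elements. *)
Definition eval_int (a b : int) : {rmorphism {poly int} -> Y} :=
  pair_rmorph (horner_eval a) (horner_eval b).

Lemma intr_horner_F3 (p : {poly int}) (a : int) :
  (3 %| a)%Z -> (p.[a])%:~R = (p.[0])%:~R :> 'F_3.
Proof.
rewrite -intr_F3_eq0 => /eqP a0.
by rewrite -!(horner_map (intr : {rmorphism int -> 'F_3})) /= a0.
Qed.

(** * The morphism to Z/9 *)

Section BaseChange.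
Variables (E : comPzRingType) (q : {rmorphism E -> Y}).
Hypothesis q_eq : forall z, Y_X1 (q z) = Y_X2 (q z).

Definition to_Zp9 (z : E) : 'Z_9 := (2 * (q z).1 - (q z).2)%:~R.

Lemma equalizer_dvd3 z : exists k, (q z).1 = (q z).2 + k * 3.
Proof.
have /(congr1 snd) /= /eqP := q_eq z.
rewrite -subr_eq0 -rmorphB intr_F3_eq0 => /dvdzP[k zk].
by exists k; rewrite -zk addrC subrK.
Qed.

Fact to_Zp9_is_zmod_morphism : zmod_morphism to_Zp9.
Proof.
move=> x y; rewrite /to_Zp9 -[RHS]rmorphB (rmorphB q); congr (_%:~R).
by rewrite /=; ring.
Qed.

(** For [(b + 3k, b)] and [(d + 3l, d)], the product of the values exceeds the value of the product
    by [18kl], which is 0 modulo 9. *)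
Fact to_Zp9_is_monoid_morphism : monoid_morphism to_Zp9.
Proof.
split=> [|x y]; first by rewrite /to_Zp9 rmorph1; apply: val_inj.
rewrite /to_Zp9 (rmorphM q) -[RHS]rmorphM /=.
have [k ->] := equalizer_dvd3 x; have [l ->] := equalizer_dvd3 y.
apply/eqP; rewrite eq_sym -subr_eq0 -rmorphB; apply/eqP.
transitivity ((9 * (2 * k * l))%:~R : 'Z_9); first by congr (_%:~R); ring.
by rewrite rmorphM [X in X * _](_ : _ = 0) ?mul0r //; apply: val_inj.
Qed.

Lemma to_Zp9_modl z : (to_Zp9 z : nat)%:R = (q z).1%:~R :> 'F_3.
Proof.
transitivity (Zp9_to_F3 (to_Zp9 z)) => //.
rewrite /to_Zp9 rmorph_int; have [k ->] := equalizer_dvd3 z.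
apply/eqP; rewrite -subr_eq0 -rmorphB intr_F3_eq0; apply/dvdzP.
by exists k; ring.
Qed.

Lemma to_Zp9_modr z : (to_Zp9 z : nat)%:R = (q z).2%:~R :> 'F_3.
Proof.
rewrite to_Zp9_modl; have [k ->] := equalizer_dvd3 z.
apply/eqP; rewrite -subr_eq0 -rmorphB intr_F3_eq0; apply/dvdzP.
by exists k; ring.
Qed.

End BaseChange.

(** * Reduction of [Y] and [X] modulo 3 *)

Definition Y_mod3 : {rmorphism Y -> ('F_3 * 'F_3)%type} := prod_rmorph intr intr.
Definition X_mod3 : {rmorphism X -> ('F_3 * 'F_3 * 'F_3)%type} :=
  prod_rmorph Y_mod3 idfun.
Definition lift_Y (t : 'F_3 * 'F_3) : Y := ((t.1 : nat) : int, (t.2 : nat) : int).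
Definition lift_X (t : 'F_3 * 'F_3 * 'F_3) : X := (lift_Y t.1, t.2).

Lemma lift_YK : cancel lift_Y Y_mod3.
Proof. by case=> s t; congr pair; apply: (@natr_Zp 1). Qed.

Lemma lift_XK : cancel lift_X X_mod3.
Proof. by case=> s t; congr pair; apply: lift_YK. Qed.

(** The sign in [(3, -3)] leaves the ideal [3Y] unchanged but makes [2a - b] equal to 9, so that the
    generator dies in Z/9. *)
Lemma Y_mod3_eq0 y : Y_mod3 y = 0 -> exists v, y = (3, -3) * v.
Proof.
case: y => a b [] /eqP; rewrite intr_F3_eq0 => /dvdzP[k ->] /eqP.
rewrite intr_F3_eq0 => /dvdzP[l ->]; exists (k, - l).
by congr pair; rewrite /=; ring.
Qed.

Lemma X_mod3_eq0 x : X_mod3 x = 0 -> exists v, x = ((3, -3), 0) * v.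
Proof.
case: x => y c xc0.
have /Y_mod3_eq0[v ->] : Y_mod3 y = 0 by exact: (congr1 fst xc0).
have c0 : c = 0 by exact: (congr1 snd xc0).
by exists (v, 0); congr pair; rewrite /= mul0r.
Qed.

(** * The unstable coequalizer *)

Theorem proposition3p3 : ~ has_stable_coequalizers dual_pure.
Proof.
move=> /(_ X Y Y_X1 Y_X2 Y_X1_pure Y_X2_pure) [E [q [[/= q_comp q_univ] stab]]].
have q_eq z : Y_X1 (q z) = Y_X2 (q z).
  exact: (congr1 (fun h : {rmorphism E -> X} => h z) q_comp).
have [phi phiE] := rmorphism_of (to_Zp9_is_zmod_morphism q)
  (to_Zp9_is_monoid_morphism q_eq).
have phi_surj s : exists z, phi z = s.
  exists (s : nat)%:R; rewrite rmorph_nat; exact: (@natr_Zp 7).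
(* The equalizer contains [(3, -3)]: evaluations at 3 and -3 both agree with evaluation at 0 modulo
   3. *)
have [g qg] : exists g, q g = (3, -3).
  have t_comp : comRing_comp Y_X1 (eval_int 3 (-3)) =
                comRing_comp Y_X2 (eval_int 3 (-3)).
    apply: rmorphism_eq => p; congr pair.
    by rewrite /= /horner_eval !intr_horner_F3.
  have [u [u_q _]] := q_univ {poly int} (eval_int 3 (-3)) t_comp.
  exists (u 'X).
  transitivity (eval_int 3 (-3) 'X); first by rewrite -u_q.
  by congr pair; rewrite /= /horner_eval hornerX.
have phig : phi g = 0 by rewrite phiE /to_Zp9 qg; apply: val_inj.
pose psi_Y : {rmorphism 'Z_9 -> ('F_3 * 'F_3)%type} :=
  pair_rmorph Zp9_to_F3 Zp9_to_F3.
pose psi_X : {rmorphism 'Z_9 -> ('F_3 * 'F_3 * 'F_3)%type} :=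
  pair_rmorph psi_Y Zp9_to_F3.
have psi_YE z : psi_Y (phi z) = Y_mod3 (q z).
  by rewrite phiE; congr pair; [apply: to_Zp9_modl|apply: to_Zp9_modr].
have psi_XE z : psi_X (phi z) = X_mod3 (Y_X1 (q z)).
  by congr pair; [apply: psi_YE|rewrite phiE; apply: to_Zp9_modl].
have pY := prod_pushout phi_surj psi_YE lift_YK phig.
have {}pY := pY (fun y => eq_ind_r (fun c => _ -> exists v, y = c * v)
  (@Y_mod3_eq0 y) qg).
have q2g : comRing_comp Y_X1 q g = ((3, -3), 0).
  by rewrite /= /pair_rmorph /= qg; congr pair; apply: val_inj.
have pX := @prod_pushout _ _ _ _ phi (comRing_comp Y_X1 q) _ _ _ g
  phi_surj psi_XE lift_XK phig.
have {}pX := pX (fun x => eq_ind_r (fun c => _ -> exists v, x = c * v)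
  (@X_mod3_eq0 x) q2g).
have h_pure : pure (pair_rmorph idfun phi).
  exact: (@retract_pure _ _ _ (fst : {rmorphism E * 'Z_9 -> E})).
(* On the second factor the base-changed pair sends [(s, t)] to [(s, t, s)] and [(s, t, t)]. *)
pose f' : {rmorphism Y * ('F_3 * 'F_3) -> X * ('F_3 * 'F_3 * 'F_3)} :=
  prod_rmorph Y_X1 (pair_rmorph idfun fst).
pose g' : {rmorphism Y * ('F_3 * 'F_3) -> X * ('F_3 * 'F_3 * 'F_3)} :=
  prod_rmorph Y_X2 (pair_rmorph idfun snd).
have [||||b_comp b_univ] := stab _ _ h_pure _ _ _ _ _ _ f' g' pX pY.
- by apply: rmorphism_eq.
- by apply: rmorphism_eq.
- by apply: rmorphism_eq => -[z s]; congr pair; rewrite /= q_eq.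
- by apply: rmorphism_eq.
pose b : {rmorphism E * 'Z_9 -> Y * ('F_3 * 'F_3)} := prod_rmorph q psi_Y.
(* [u a] picks out [(0, a)]; [u 3] and [u 0] differ in Z/9 but agree after [b], which reduces modulo
   3. *)
pose u (a : int) : {rmorphism {poly int} -> E * 'Z_9} :=
  pair_rmorph (intr \o horner_eval 0) (intr \o horner_eval a).
have bu : comRing_comp b (u 3) = comRing_comp b (u 0).
  apply: rmorphism_eq => p; congr pair.
  by congr pair; rewrite /= /horner_eval !rmorph_int intr_horner_F3.
have bu_comp : comRing_comp f' (comRing_comp b (u 0)) =
               comRing_comp g' (comRing_comp b (u 0)).
  by rewrite !comRing_compmA; congr (comRing_comp _ (u 0)).
(* Both [u 3] and [u 0] factor the same morphism through [b], so uniqueness would give 3 = 0 in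
   Z/9. *)
have [v [_ v_uniq]] := b_univ {poly int} (comRing_comp b (u 0)) bu_comp.
have u30 : u 3 = u 0 by rewrite -(v_uniq _ bu) -(v_uniq (u 0) erefl).
have := congr1 (fun h : {rmorphism {poly int} -> _} => (h 'X).2) u30.
by rewrite /= /horner_eval !hornerX => /(congr1 val).
Qed.
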